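(* Let $(N^{2n+1},\xi)$ be the prequantization of a monotone Bott manifold $(B^{2n},[\omega]=c_1(B^{2n}))$, with reflexive moment polytope $\mathcal{P}\subset\mathbb{R}^n$, and let $\mathcal{D}=-\mathcal{P}^*\subset\mathbb{R}^n$ be its toric diagram. Then $$h^*_k(\mathcal{D})=\binom{n}{k},\qquad k=0,\dots,n.$$ In particular, all these $(N^{2n+1},\xi)$ are flexible and the corresponding toric diagrams provide a family of polytopes that are Ehrhart equivalent to the cross-polytope, i.e. for any such toric diagram $\mathcal{D}\subset\mathbb{R}^n$ we have that $$L_{\mathcal{D}}(t)=L_{\diamond}(t)=\sum_{k=0}^n\binom{n}{k}\binom{t+n-k}{n}.$$
   Context: Bott manifolds: a Bott manifold of complex dimension $n$ is the top space $B_n$ of an iterated $\mathbb{CP}^1$-bundle $B_n\to B_{n-1}\to\cdots\to B_1=\mathbb{CP}^1\to B_0=\{\text{point}\}$ with $B_i=\mathbb{P}(\xi_i\oplus\mathbb{C})$, $\xi_i\to B_{i-1}$ a complex line bundle; it is a toric manifold of real dimension $2n$, written $B^{2n}$. It is monotone if it is equipped with a toric symplectic form $\omega$ with $[\omega]=c_1$ (convention: $c_1(M)$ is normalized so that $\frac{1}{2\pi}c_1(M)$ is the integral first Chern class). Its moment polytope can then be translated to a reflexive Delzant polytope $\mathcal{P}=\bigcap_{j=1}^d\{x\in\mathbb{R}^n: x\cdot\nu_j+1\ge 0\}$, with $\nu_j\in\mathbb{Z}^n$ the primitive interior facet normals. Polar dual: $\mathcal{P}^*=\{x\in\mathbb{R}^n: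 x\cdot y\le 1\ \forall y\in\mathcal{P}\}$; so $-\mathcal{P}^*=\operatorname{conv}(\nu_1,\dots,\nu_d)$. An integral polytope $\mathcal{P}$ is reflexive if $\mathcal{P}^*$ is integral. A Delzant polytope is a simple $n$-polytope such that at every vertex the $n$ primitive edge vectors form a basis of $\mathbb{Z}^n$. A toric diagram is an integral simplicial $n$-polytope $\mathcal{D}\subset\mathbb{R}^n$ all of whose facets are unimodular simplices (the $n$ vertices of each facet can be translated to form a basis of $\mathbb{Z}^n$). Toric diagrams $\mathcal{D}=\operatorname{conv}(v_1,\dots,v_d)$, up to unimodular equivalence (integral translations and $GL(n,\mathbb{Z})$), correspond bijectively to Gorenstein toric contact manifolds (good toric contact manifolds with zero first Chern class) $(N_{\mathcal{D}}^{2n+1},\xi_{\mathcal{D}})$: the moment cone of the symplectization has defining normals $(v_j,1)\in\mathbb{Z}^{n+1}$. The prequantization of $(M^{2n},\omega)$ is the $S^1$-bundle over $M$ with Chern class $\frac{1}{2\pi}[\omega]\in H^2(M;\mathbb{Z})$, with contact structure the horizontal distribution of a connection form with curvature $\frac{1}{2\pi}\omega$. The prequantization of a monotone toric $(M,[\omega]=c_1(M))$ with reflexive moment polytope $\mathcal{P}$ is the Gorenstein toric contact manifold with toric diagram $-\mathcal{P}^*$. Ehrhart polynomial: $L_{\mathcal{D}}(t)=\#(t\mathcal{D}\cap\mathbb{Z}^n)$, $t\in\mathbb{Z}_{>0}$, written $L_{\mathcal{D}}(t)=\sum_{k=0}^n h^*_k(\mathcal{D})\binom{t+n-k}{n}$,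 which defines the coefficients $h^*_k(\mathcal{D})$. Two toric diagrams are Ehrhart equivalent if they have the same Ehrhart polynomial. The contact Betti numbers $cb_*(N_{\mathcal{D}},\xi_{\mathcal{D}})$ (ranks of cylindrical contact homology) vanish in negative and odd degrees and satisfy $h^*_{n-k}(\mathcal{D})=cb_{2k}-cb_{2(k-1)}$, so they are equivalent data to $L_{\mathcal{D}}$. $(N_{\mathcal{D}},\xi_{\mathcal{D}})$ is rigid if it is completely determined, as a toric contact manifold, by its contact Betti numbers; equivalently, if $\mathcal{D}$ is Ehrhart determined: every toric diagram $\mathcal{D}'$ with $L_{\mathcal{D}'}=L_{\mathcal{D}}$ is unimodularly equivalent to $\mathcal{D}$. It is flexible if it is not rigid. Cross-polytope: $\diamond_n=\{x\in\mathbb{R}^n:|x_1|+\cdots+|x_n|\le 1\}$; $L_{\diamond}$ denotes the Ehrhart polynomial of $\diamond_n$.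
   Formalization: Flexibility is claimed only for n ≥ 2; for n = 1 the diagram is [-1,1], with L(t) = 2t+1, and every integral segment is determined by its length, so it is rigid (n = 0 is likewise rigid). *)

(* Defs.v *)
From HB Require Import structures.
From mathcomp Require Import all_boot all_order all_algebra finmap.
From mathcomp Require Import all_classical all_reals.

Set Implicit Arguments.
Unset Strict Implicit.
Unset Printing Implicit Defensive.

Import Order.TTheory GRing.Theory Num.Theory.

Local Open Scope classical_set_scope.
Local Open Scope ring_scope.

(* Points of R^n and of Z^n are row vectors; GL(n, Z) acts on the right, and
   lattice points are sent to R^n by [map_mx intr]. *)

Section Polytopes.
Variable R : realType.
Implicit Types n m : nat.

Definition dot n (x y : 'rV[R]_n) : R := \sum_i x 0 i * y 0 i.

Definition conv_hull m n (V : 'M[R]_(m, n)) : set 'rV[R]_n :=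
  [set w *m V | w in [set w : 'rV[R]_m |
                        (forall j, 0 <= w 0 j) /\ \sum_j w 0 j = 1]].

Definition affinely_independent m n (V : 'M[R]_(m, n)) : Prop :=
  row_free (row_mx V (const_mx 1 : 'cV[R]_m)).

(* [affine_rank S m] : the affine hull of S has dimension m - 1. *)
Definition affine_rank n (S : set 'rV[R]_n) m : Prop :=
  (exists V : 'M[R]_(m, n),
      affinely_independent V /\ forall i, S (row i V)) /\
  ~ (exists V : 'M[R]_(m.+1, n),
      affinely_independent V /\ forall i, S (row i V)).

Definition is_polytope n (P : set 'rV[R]_n) : Prop :=
  affine_rank P n.+1 /\ exists m (V : 'M[R]_(m, n)), P = conv_hull V.

Definition integral_polytope n (P : set 'rV[R]_n) : Prop :=
  exists m (V : 'M[int]_(m, n)), P = conv_hull (map_mx intr V).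

Definition face n (P F : set 'rV[R]_n) : Prop :=
  exists (a : 'rV[R]_n) (b : R),
    (forall x, P x -> dot x a <= b) /\ F = [set x | P x /\ dot x a = b].

Definition vertex n (P : set 'rV[R]_n) (p : 'rV[R]_n) : Prop :=
  face P [set p].

Definition edge n (P E : set 'rV[R]_n) : Prop :=
  face P E /\ affine_rank E 2.

Definition facet n (P F : set 'rV[R]_n) : Prop :=
  face P F /\ affine_rank F n.

(* The rows of B are the n primitive edge vectors at p (rows of a unimodular
   matrix are primitive); that the n edges [p, p + s_i B_i] are all the edges
   of P through p says that P is simple at p. *)
Definition delzant n (P : set 'rV[R]_n) : Prop :=
  is_polytope P /\
  forall p, vertex P p ->
    exists (B : 'M[int]_n) (s : 'I_n -> R),
      B \in unitmx /\ (forall i, 0 < s i) /\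
      [set E | edge P E /\ E p] =
      [set conv_hull (col_mx p (p + s i *: map_mx intr (row i B))) | i in setT].

Definition polar n (P : set 'rV[R]_n) : set 'rV[R]_n :=
  [set x | forall y, P y -> dot x y <= 1].

Definition reflexive_polytope n (P : set 'rV[R]_n) : Prop :=
  is_polytope P /\ integral_polytope P /\ integral_polytope (polar P).

Definition primitive_vector n (v : 'rV[int]_n) : Prop :=
  \big[gcdn/0%N]_i absz (v 0 i) = 1%N.

(* The points of P minimizing the scalar product with nu. *)
Definition min_face n (P : set 'rV[R]_n) (nu : 'rV[int]_n) : set 'rV[R]_n :=
  [set p | P p /\
     forall x, P x -> dot p (map_mx intr nu) <= dot x (map_mx intr nu)].

(* Primitive interior normals of the facets. *)
Definition facet_normal n (P : set 'rV[R]_n) (nu : 'rV[int]_n) : Prop :=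
  primitive_vector nu /\ facet P (min_face P nu).

(* The normal fan of a Delzant polytope.  A simplicial fan is encoded by its
   maximal cones, and each of these by the set of its primitive ray generators;
   here the cone at a vertex p is generated by the normals of the facets
   through p. *)
Definition normal_fan n (P : set 'rV[R]_n) : set (set 'rV[int]_n) :=
  [set [set nu | facet_normal P nu /\ min_face P nu p] | p in vertex P].

End Polytopes.

(* Fans of Bott towers.  If a toric manifold B has fan F, every complex line
   bundle xi over B has c_1(xi) = sum_v a(v) [D_v], the sum being over the rays
   v of F, with D_v the divisor of v and integers a(v); the fan of P(xi + C)
   then has rays (a(v), v) and (+-1, 0), and maximal cones generated by the
   lifts of the rays of a maximal cone of F together with one of (+-1, 0).  (The
   fibre coordinate is put first; the sign of a is immaterial, since a is
   arbitrary.) *)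
Definition lift_ray n (a : 'rV[int]_n -> int) (v : 'rV[int]_n) :
    'rV[int]_(1 + n) := row_mx (a v)%:M v.

Definition fibre_ray n (b : bool) : 'rV[int]_(1 + n) :=
  row_mx ((-1) ^+ b)%:M 0.

Definition projective_bundle_fan n (F : set (set 'rV[int]_n))
    (a : 'rV[int]_n -> int) : set (set 'rV[int]_(1 + n)) :=
  [set C | exists s b, F s /\ C = lift_ray a @` s `|` [set fibre_ray n b]].

(* The last constructor allows the choice of another basis of the lattice. *)
Inductive bott_fan : forall n, set (set 'rV[int]_n) -> Prop :=
| bott_point : @bott_fan 0 [set set0]
| bott_bundle n (F : set (set 'rV[int]_n)) (a : 'rV[int]_n -> int) :
    bott_fan F -> @bott_fan n.+1 (projective_bundle_fan F a)
| bott_basis n (F : set (set 'rV[int]_n)) (A : 'M[int]_n) :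
    A \in unitmx -> bott_fan F ->
    bott_fan [set [set v *m A | v in s] | s in F].

Section ToricDiagrams.
Variable R : realType.
Implicit Types n : nat.

(* P is the moment polytope of a monotone Bott manifold, translated so that all
   its facets are at lattice distance one from the origin; the toric manifold
   underlying a Delzant polytope is the one given by its normal fan. *)
Record monotone_bott_polytope n (P : set 'rV[R]_n) : Prop := {
  mbp_delzant : delzant P;
  mbp_reflexive : reflexive_polytope P;
  mbp_monotone : P = [set x | forall nu, facet_normal P nu ->
                                0 <= dot x (map_mx intr nu) + 1];
  mbp_bott : bott_fan (normal_fan P) }.

(* - P^*, the toric diagram of the prequantization of the monotone toric
   manifold with reflexive moment polytope P. *)
Definition prequantization_diagram n (P : set 'rV[R]_n) : set 'rV[R]_n :=
  [set - x | x in polar P].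

Definition unimodular_simplex n (F : set 'rV[R]_n) : Prop :=
  exists V : 'M[int]_n, F = conv_hull (map_mx intr V) /\
    exists w : 'rV[int]_n, \matrix_i (row i V + w) \in unitmx.

Definition toric_diagram n (D : set 'rV[R]_n) : Prop :=
  is_polytope D /\ integral_polytope D /\
  forall F, facet D F -> unimodular_simplex F.

Definition unimodular_equiv n (D D' : set 'rV[R]_n) : Prop :=
  exists (A : 'M[int]_n) (w : 'rV[int]_n), A \in unitmx /\
    D' = [set x *m map_mx intr A + map_mx intr w | x in D].

Definition ehrhart n (D : set 'rV[R]_n) (t : nat) : nat :=
  #|` fset_set [set z : 'rV[int]_n |
                  [set t%:R *: x | x in D] (map_mx intr z)]|.

Definition ehrhart_equiv n (D D' : set 'rV[R]_n) : Prop :=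
  forall t, (0 < t)%N -> ehrhart D t = ehrhart D' t.

Definition is_hstar n (D : set 'rV[R]_n) (h : {ffun 'I_n.+1 -> rat}) : Prop :=
  forall t, (0 < t)%N ->
    (ehrhart D t)%:R = \sum_(k < n.+1) h k * 'C(t + n - k, n)%:R.

(* [is_hstar D] has at most one solution, and it has one for every integral
   polytope D; the default value 0 is never that of a nonempty D. *)
Definition hstar n (D : set 'rV[R]_n) : {ffun 'I_n.+1 -> rat} :=
  xget 0 [set h | is_hstar D h].

(* The contact Betti number cb_i of the Gorenstein toric contact manifold with
   diagram D: they vanish in odd degrees, and
   h^*_(n-k) = cb_(2k) - cb_(2(k-1)) for all k, where h^*_(n-k) = 0 if n < k. *)
Definition contact_betti n (D : set 'rV[R]_n) (i : nat) : rat :=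
  if odd i then 0
  else \sum_(j < n.+1 | (j <= i./2)%N) hstar D (rev_ord j).

(* Gorenstein toric contact manifolds are identified with toric diagrams up to
   unimodular equivalence. *)
Definition rigid n (D : set 'rV[R]_n) : Prop :=
  forall D' : set 'rV[R]_n, toric_diagram D' ->
    contact_betti D' =1 contact_betti D -> unimodular_equiv D D'.

Definition flexible n (D : set 'rV[R]_n) : Prop := ~ rigid D.

Definition cross_polytope n : set 'rV[R]_n :=
  [set x | \sum_i `|x 0 i| <= 1].

End ToricDiagrams.

Arguments cross_polytope R n : clear implicits.

(* Main.v *)
Require Import Defs.
From mathcomp Require Import all_boot all_order all_algebra finmap.
From mathcomp Require Import all_classical all_reals.
From mathcomp Require Import zify ring lra.

(** The whole argument rests on a bijection of the lattice.  For the fan of a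
    Bott manifold, the degree of a lattice point [z] is the sum of its
    coefficients on the generators of a cone containing it.  In the fan of
    [P(xi + C)] the point [(x, z)] has degree [deg z + |x - phi z|], where [phi]
    is the piecewise linear function of the line bundle; the shear
    [(x, z) |-> (x - phi z, z)] makes this the degree of a product.  By induction
    on the tower a bijection of [Z^n] carries the degree to the l1-norm.

    At a vertex [p] of [P] the facet normals satisfy [nu . p = -1]: this integer
    is at least [-1] by monotonicity and at most [0] since [0] is in [P], and it
    is not [0] since the polar is bounded.  So [- p] computes the degree on the
    cone at [p], and the lattice points of [t D] are those of degree at most
    [t], as many as in [t] times the cross-polytope.

    Flexibility: of the diagrams of [(CP^1)^n] and [H_1 x (CP^1)^(n-2)], with
    [H_1] a Hirzebruch surface, only the first is centrally symmetric, so a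
    diagram with the same Ehrhart polynomial cannot be equivalent to both. *)

Set Implicit Arguments.
Unset Strict Implicit.
Unset Printing Implicit Defensive.

Import Order.TTheory GRing.Theory Num.Theory.

Local Open Scope classical_set_scope.
Local Open Scope ring_scope.

(** * Scalar products and convex hulls *)

Section Dot.
Variable R : realType.
Implicit Types n : nat.

Lemma dotC n (x y : 'rV[R]_n) : dot x y = dot y x.
Proof. by apply: eq_bigr => i _; rewrite mulrC. Qed.

Lemma dotZl n c (x y : 'rV[R]_n) : dot (c *: x) y = c * dot x y.
Proof. by rewrite /dot mulr_sumr; apply: eq_bigr => i _; rewrite mxE mulrA. Qed.

Lemma dotZr n c (x y : 'rV[R]_n) : dot x (c *: y) = c * dot x y.
Proof. by rewrite dotC dotZl dotC. Qed.

Lemma dotNl n (x y : 'rV[R]_n) : dot (- x) y = - dot x y.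
Proof. by rewrite -scaleN1r dotZl mulN1r. Qed.

Lemma dotDl n (x1 x2 y : 'rV[R]_n) : dot (x1 + x2) y = dot x1 y + dot x2 y.
Proof. by rewrite /dot -big_split; apply: eq_bigr => i _; rewrite mxE mulrDl. Qed.

Lemma dot0l n (y : 'rV[R]_n) : dot 0 y = 0.
Proof. by rewrite -(scale0r y) dotZl mul0r. Qed.

Lemma dot_sumr n (I : finType) (A : {pred I}) (F : I -> 'rV[R]_n) (y : 'rV[R]_n) :
  dot (\sum_(i in A) F i) y = \sum_(i in A) dot (F i) y.
Proof.
exact: (big_morph (fun x => dot x y) (fun u v => dotDl u v y) (dot0l y)).
Qed.

Lemma dot_mulmx m n (w : 'rV[R]_m) (V : 'M[R]_(m, n)) (y : 'rV[R]_n) :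
  dot (w *m V) y = \sum_j w 0 j * dot (row j V) y.
Proof.
rewrite /dot.
under eq_bigr do rewrite mxE mulr_suml.
rewrite exchange_big; apply: eq_bigr => j _.
by rewrite mulr_sumr; apply: eq_bigr => i _; rewrite !mxE mulrA.
Qed.

Lemma dot_delta n i (y : 'rV[R]_n) : dot (delta_mx 0 i) y = y 0 i.
Proof.
rewrite /dot (bigD1 i) //= big1 => [|j ji]; rewrite !mxE ?eqxx ?mul1r ?addr0 //.
by rewrite (negPf ji) mul0r.
Qed.

Lemma mulmx_trE m n (W : 'M[R]_(m, n)) (y : 'rV[R]_n) i :
  (W *m y^T) i 0 = dot (row i W) y.
Proof. by rewrite mxE; apply: eq_bigr => j _; rewrite !mxE. Qed.

Lemma conv_hull_row m n (V : 'M[R]_(m, n)) j : conv_hull V (row j V).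
Proof.
exists (delta_mx 0 j); last by rewrite -rowE.
split=> [i|]; first by rewrite mxE /= ler0n.
rewrite (bigD1 j) //= big1 => [|i ij]; rewrite mxE ?eqxx ?addr0 //=.
by rewrite (negPf ij).
Qed.

Lemma conv_hull_ge m n (V : 'M[R]_(m, n)) (y : 'rV[R]_n) c x :
  (forall j, c <= dot (row j V) y) -> conv_hull V x -> c <= dot x y.
Proof.
move=> Vc [w [w0 w1] <-]; rewrite dot_mulmx.
apply: (@le_trans _ _ (\sum_j w 0 j * c)); first by rewrite -mulr_suml w1 mul1r.
by apply: ler_sum => j _; exact: ler_wpM2l.
Qed.

(** A weighted mean of numbers at least [c] equals [c] only if every number of nonzero weight
    does. *)
Lemma conv_hull_tight m n (V : 'M[R]_(m, n)) (y : 'rV[R]_n) c (w : 'rV[R]_m) :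
  (forall j, 0 <= w 0 j) -> \sum_j w 0 j = 1 ->
  (forall j, c <= dot (row j V) y) -> dot (w *m V) y = c ->
  forall j, w 0 j != 0 -> dot (row j V) y = c.
Proof.
move=> w0 w1 Vc; rewrite dot_mulmx => /eqP.
rewrite -subr_eq0 -[X in _ - X]mul1r -w1 mulr_suml -sumrB psumr_eq0 => [/allP h j wj|j _].
  have := h j (mem_index_enum j); rewrite /= -mulrBr mulf_eq0 (negPf wj) /=.
  by rewrite subr_eq0 => /eqP.
by rewrite -mulrBr mulr_ge0 // subr_ge0.
Qed.

(** Products of weights are again weights. Rows of zero weight are left unconstrained, so that for a
    point of a facet only the spanning points on that facet have to be located. *)
Lemma conv_hull_comb m k n (U : 'M[R]_(m, n)) (V : 'M[R]_(k, n)) (w : 'rV[R]_m) :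
  (forall j, 0 <= w 0 j) -> \sum_j w 0 j = 1 ->
  (forall j, w 0 j != 0 -> conv_hull V (row j U)) -> conv_hull V (w *m U).
Proof.
move=> w0 w1 UV.
have /choice [f fP] j : exists v : 'rV[R]_k, w 0 j != 0 ->
    [/\ forall i, 0 <= v 0 i, \sum_i v 0 i = 1 & v *m V = row j U].
  have [wj|/negPf wj] := boolP (w 0 j != 0); last by exists 0.
  by have [v [v0 v1] vV] := UV j wj; exists v.
exists (w *m \matrix_j f j).
  split=> [i|].
    rewrite mxE sumr_ge0 // => j _; rewrite mxE.
    have [->|wj] := eqVneq (w 0 j) 0; first by rewrite mul0r.
    by have [f0 _ _] := fP j wj; rewrite mulr_ge0.
  under eq_bigr do rewrite mxE.
  rewrite exchange_big /= -[RHS]w1; apply: eq_bigr => j _.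
  rewrite -mulr_sumr; under eq_bigr do rewrite mxE.
  have [->|wj] := eqVneq (w 0 j) 0; first by rewrite mul0r.
  by have [_ -> _] := fP j wj; rewrite mulr1.
rewrite -mulmxA; apply/rowP => i; rewrite !mxE; apply: eq_bigr => j _.
have [->|wj] := eqVneq (w 0 j) 0; first by rewrite !mul0r.
have [_ _ /rowP/(_ i)] := fP j wj; rewrite !mxE => <-; congr (_ * _).
by apply: eq_bigr => l _; rewrite !mxE.
Qed.

Lemma conv_hull_sub m k n (U : 'M[R]_(m, n)) (V : 'M[R]_(k, n)) x :
  (forall j, conv_hull V (row j U)) -> conv_hull U x -> conv_hull V x.
Proof. by move=> UV [w [w0 w1] <-]; apply: conv_hull_comb. Qed.

Lemma map_intr_unitmx n (V : 'M[int]_n) :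
  V \in unitmx -> map_mx intr V \in @unitmx R n.
Proof. by rewrite !unitmxE det_map_mx; apply: rmorph_unit. Qed.

End Dot.

(** * Fans of Bott towers and the l1-norm *)

(* [C] is the set of maximal cones, each given by a matrix whose rows are its
   generators; [psi] carries the degree of a lattice point to its l1-norm. *)
Definition l1_fan n (C : 'M[int]_n -> Prop) (psi : 'rV[int]_n -> 'rV[int]_n) :=
  (forall V, C V -> V \in unitmx) /\
  forall z, exists V (a : 'rV[int]_n),
  [/\ C V, forall i, 0 <= a 0 i, z = a *m V &
    \sum_i a 0 i = \sum_i `|psi z 0 i|].

Lemma bott_fan_l1 n (F : set (set 'rV[int]_n)) : bott_fan F ->
  exists psi, bijective psi /\
    l1_fan [set V | V \in unitmx /\ F [set row i V | i in setT]] psi.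
Proof.
elim=> {n F} [|n F alpha _ [psi [[psi' psiK psiK'] [_ psiP]]]
              |n F A Au _ [psi [[psi' psiK psiK'] [_ psiP]]]].
- exists id; split; first by exists id.
  split=> [V [] //|z]; exists 1%:M, 0; split.
  + split; first exact: unitmx1.
    by apply/seteqP; split => // x [[]].
  + by case.
  + by apply/rowP; case.
  + by rewrite !big_ord0.
- have /choice [V /choice [a VP]] := psiP.
  (* [phi] extends [alpha] linearly over the cone chosen for [z]. A shear by any function of the
     base point is invertible. *)
  pose phi z := \sum_i a z 0 i * alpha (row i (V z)).
  pose f (z : 'rV[int]_(1 + n)) : 'rV[int]_(1 + n) :=
    row_mx (lsubmx z - (phi (rsubmx z))%:M) (psi (rsubmx z)).
  exists f; split.
    exists (fun z : 'rV[int]_(1 + n) =>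
      row_mx (lsubmx z + (phi (psi' (rsubmx z)))%:M) (psi' (rsubmx z))) => z.
      by rewrite /f row_mxKr row_mxKl psiK subrK hsubmxK.
    by rewrite /f row_mxKr row_mxKl psiK' addrK hsubmxK.
  split=> [W [] //|z].
  set z' := @rsubmx _ 1 1 n z; set e := @lsubmx _ 1 1 n z 0 0 - phi z'.
  have [[Vu FV] a0 zE aE] := VP z'.
  (* The sign of the sheared fibre coordinate [e] selects the fibre ray; [W] is block triangular
     with diagonal blocks of determinant +-1. *)
  pose W : 'M[int]_(1 + n) := block_mx ((-1) ^+ (e < 0)%R)%:M 0
     (\col_i alpha (row i (V z'))) (V z').
  have rowL : row (lshift n 0) W = fibre_ray n (e < 0).
    rewrite rowKu row_row_mx /fibre_ray; congr (row_mx _ _).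
      by apply/rowP => k; rewrite !mxE ord1.
    by apply/rowP => k; rewrite !mxE.
  have rowR j : row (rshift 1 j) W = lift_ray alpha (row j (V z')).
    rewrite rowKd row_row_mx /lift_ray; congr (row_mx _ _).
    by apply/rowP => k; rewrite !mxE ord1 eqxx.
  pose b : 'rV[int]_(1 + n) := row_mx (`|e|)%:M (a z').
  have bL : b 0 (lshift n 0) = `|e| by rewrite row_mxEl mxE eqxx mulr1n.
  have bR j : b 0 (rshift 1 j) = a z' 0 j by rewrite row_mxEr.
  exists W, b; split.
  + split.
      rewrite unitmxE [\det _](@det_lblock _ 1 n) unitrM.
      by rewrite det_scalar expr1 unitrX //= -unitmxE.
    exists [set row i (V z') | i in setT], (e < 0); split=> //.
    apply/seteqP; split => x.
      move=> [i _ <-]; case: (@split_ordP 1 n i) => j ->.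
        by right; rewrite ord1 rowL.
      by left; exists (row j (V z')); [exists j|rewrite rowR].
    case=> [[_ [j _ <-] <-]|->].
      by exists (rshift 1 j).
    by exists (@lshift 1 n 0).
  + move=> i; case: (@split_ordP 1 n i) => j ->.
      by rewrite ord1 bL.
    by rewrite bR.
  (* The fibre coordinate of the combination is [|e|] times the sign of [e], plus [phi z']. *)
  + rewrite [RHS](@mul_row_block _ 1 1 n 1 n) mulmx0 add0r -zE -[LHS](@hsubmxK _ 1 1 n).
    apply: (congr1 (fun u => @row_mx int 1 1 n u z')); apply/rowP => k.
    rewrite !ord1 !mxE big_ord1 !mxE eqxx !mulr1n.
    rewrite mulrC -numEsign -[LHS](subrK (phi z')); congr (_ + _).
      by rewrite /e !mxE.
    by apply: eq_bigr => i _; rewrite mxE.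
  + have fL : f z 0 (lshift n 0) = e by rewrite row_mxEl /e !mxE eqxx mulr1n.
    have fR j : f z 0 (rshift 1 j) = psi z' 0 j by rewrite row_mxEr.
    rewrite (@big_split_ord _ _ _ 1 n) [RHS](@big_split_ord _ _ _ 1 n) /= !big_ord1.
    rewrite bL fL; congr (_ + _).
    by under eq_bigr do rewrite bR; rewrite aE; under [RHS]eq_bigr do rewrite fR.
- exists (fun z => psi (z *m invmx A)); split.
    exists (fun z => psi' z *m A) => z; first by rewrite psiK mulmxKV.
    by rewrite mulmxK.
  split=> [W [] //|z]; have [V [a [[Vu FV] a0 zE aE]]] := psiP (z *m invmx A).
  exists (V *m A), a; split=> //; last by rewrite mulmxA -zE mulmxKV.
  split; first by rewrite unitmx_mul Vu.
  exists [set row i V | i in setT] => //.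
  apply/seteqP; split=> x; first by move=> [_ [i _ <-] <-]; exists i; rewrite ?row_mul.
  by move=> [i _ <-]; exists (row i V); [exists i|rewrite row_mul].
Qed.

(** * Counting the lattice points of l1-balls *)

Definition int_ball (t : nat) : seq int :=
  0 :: [seq Posz j.+1 | j <- iota 0 t] ++ [seq Negz j | j <- iota 0 t].

Lemma mem_int_ball t x : (x \in int_ball t) = (`|x| <= t)%N.
Proof.
rewrite inE mem_cat; case: x => [[//|j]|j] /=.
  rewrite (mem_map (f := fun j => Posz j.+1)) ?mem_iota /= => [|i k [] //].
  by case: mapP => [[i _ //]|_]; rewrite orbF.
rewrite (mem_map (f := Negz)) ?mem_iota /= => [|i k [] //].
by case: mapP => [[i _ //]|_].
Qed.

Lemma int_ball_uniq t : uniq (int_ball t).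
Proof.
rewrite /= cat_uniq !map_inj_uniq ?iota_uniq => [|i k [] //|i k [] //].
rewrite andbT mem_cat negb_or /=; apply/andP; split.
  by apply/andP; split; apply/mapP => -[].
by apply/hasPn => _ /mapP[i _ ->]; apply/mapP => -[].
Qed.

Fixpoint l1_ball (n t : nat) {struct n} : seq 'rV[int]_n :=
  if n is m.+1 then
    [seq (row_mx x%:M z : 'rV_(1 + m)) | x <- int_ball t, z <- l1_ball m (t - `|x|)%N]
  else [:: 0].

Lemma l1_norm_split n (z : 'rV[int]_(1 + n)) :
  \sum_i `|z 0 i| = `|lsubmx z 0 0| + \sum_i `|rsubmx z 0 i|.
Proof.
rewrite big_split_ord big_ord1 /= mxE; congr (_ + _).
by apply: eq_bigr => i _; rewrite mxE.
Qed.

Lemma mem_l1_ball n t (z : 'rV[int]_n) :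
  (z \in l1_ball n t) = (\sum_i `|z 0 i| <= t%:Z).
Proof.
elim: n t z => [|n IHn] t z.
  by rewrite big_ord0 inE; apply/eqP/rowP => -[].
rewrite [\sum_i _](@l1_norm_split n); apply/allpairsPdep/idP => [[x [y [xt yt ->]]]|zt].
  move: xt yt; rewrite mem_int_ball IHn row_mxKl row_mxKr mxE eqxx mulr1n.
  by set s := \sum_i _; lia.
exists (@lsubmx _ 1 1 n z 0 0), (@rsubmx _ 1 1 n z).
have s0 : 0 <= \sum_i `|@rsubmx _ 1 1 n z 0 i| by apply: sumr_ge0.
rewrite mem_int_ball IHn; split.
- by move: s0 zt; set s := \sum_i _; lia.
- by move: s0 zt; set s := \sum_i _; lia.
- rewrite -[LHS](@hsubmxK _ 1 1 n).
  apply: (congr1 (fun u => @row_mx int 1 1 n u _)).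
  by apply/rowP => i; rewrite !mxE !ord1 eqxx.
Qed.

Lemma l1_ball_uniq n t : uniq (l1_ball n t).
Proof.
elim: n t => // n IHn t.
apply: allpairs_uniq_dep => [|x _|]; [exact: int_ball_uniq|exact: IHn|].
move=> [x y] [x' y'] _ _ /= /(@eq_row_mx _ 1 1 n)[/rowP/(_ 0)].
by rewrite !mxE eqxx !mulr1n => -> ->.
Qed.

Lemma size_l1_ballS0 n : size (l1_ball n.+1 0) = size (l1_ball n 0).
Proof. by rewrite /= cats0 size_map. Qed.

(** Slicing by the first coordinate gives one central slice and two slices for each nonzero absolute
    value. Subtracting this count at [t] from the one at [t.+1] leaves the recurrence. *)
Lemma size_l1_ballSS n t :
  size (l1_ball n.+1 t.+1) =
  (size (l1_ball n.+1 t) + size (l1_ball n t.+1) + size (l1_ball n t))%N.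
Proof.
have E s : size (l1_ball n.+1 s) =
    (size (l1_ball n s) + (\sum_(j < s) size (l1_ball n (s - j.+1))).*2)%N.
  rewrite [l1_ball n.+1 s]/= size_cat size_map subn0.
  rewrite size_allpairs_dep map_cat -!map_comp sumn_cat -addnn; congr (_ + (_ + _))%N.
    by rewrite sumnE big_map -[s in iota 0 s]subn0 -/(index_iota 0 s) big_mkord.
  by rewrite sumnE big_map -[s in iota 0 s]subn0 -/(index_iota 0 s) big_mkord.
rewrite !E big_ord_recl /=.
rewrite (eq_bigr (fun j : 'I_t => size (l1_ball n (t - j.+1)))) // subn1 /=.
by set S := \sum_(_ < _) _; lia.
Qed.

(** The Delannoy numbers, in the shape of an h*-expansion with coefficients ['C(n, k)]. *)
Definition delannoy n t := (\sum_(k < n.+1) 'C(n, k) * 'C(t + n - k, n))%N.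

Lemma delannoy0 n : delannoy n 0 = 1%N.
Proof.
rewrite /delannoy big_ord_recl /= bin0 add0n subn0 binn mul1n big1 ?addn0 // => i _.
by rewrite [X in (_ * X)%N]bin_small ?muln0 // /bump /=; have := ltn_ord i; lia.
Qed.

(** Pascal's rule on the second factor splits off [delannoy n.+1 t]; on the first factor of what
    remains it gives the other two terms. *)
Lemma delannoyS n t :
  delannoy n.+1 t.+1 = (delannoy n.+1 t + delannoy n t.+1 + delannoy n t)%N.
Proof.
rewrite /delannoy.
rewrite (eq_bigr (fun k : 'I_n.+2 =>
    'C(n.+1, k) * 'C(t + n.+1 - k, n.+1) +
    'C(n.+1, k) * 'C(t + n.+1 - k, n)))%N; last first.
  move=> k _; rewrite -mulnDr -binS; congr (_ * 'C(_, _))%N.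
  by have := ltn_ord k; lia.
rewrite big_split /= -addnA; congr (_ + _)%N.
rewrite big_ord_recl /= [in X in (_ + X)%N](eq_bigr (fun k : 'I_n.+1 =>
   'C(n, k.+1) * 'C(t.+1 + n - k.+1, n) + 'C(n, k) * 'C(t + n - k, n)))%N; last first.
  move=> k _; rewrite /bump /= add1n binS mulnDl.
  by congr (_ * 'C(_, _) + _ * 'C(_, _))%N; lia.
rewrite big_split /= addnA; congr (_ + _)%N.
rewrite [RHS]big_ord_recl big_ord_recr /= !bin0 (bin_small (ltnSn n)) mul0n addn0.
congr (_ * 'C(_, _) + _)%N; first by lia.
Qed.

Lemma size_l1_ball n t : size (l1_ball n t) = delannoy n t.
Proof.
elim: n t => [|n IHn] t.
  by rewrite /delannoy big_ord1 !bin0.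
elim: t => [|t IHt]; first by rewrite size_l1_ballS0 IHn !delannoy0.
by rewrite size_l1_ballSS delannoyS IHt !IHn.
Qed.

(** * Ehrhart counts and h*-coefficients *)

Section Ehrhart.
Variable R : realType.

Lemma ehrhart_delannoy n (D : set 'rV[R]_n) (psi : 'rV[int]_n -> 'rV[int]_n) t :
  bijective psi ->
  (forall z, [set t%:R *: x | x in D] (map_mx intr z) <->
             \sum_i `|psi z 0 i| <= t%:Z) ->
  ehrhart D t = delannoy n t.
Proof.
move=> [psi' psiK psiK'] Dt; rewrite -size_l1_ball /ehrhart.
(* As the image of a finite list the set is finite; on an infinite set [fset_set] would be empty by
   default. *)
have -> : [set z : 'rV[int]_n | [set t%:R *: x | x in D] (map_mx intr z)] =
    [set` [fset psi' z | z in l1_ball n t]%fset].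
  apply/seteqP; split=> z /=.
    move/Dt; rewrite -mem_l1_ball => zt.
    by apply/imfsetP; exists (psi z).
  by move=> /imfsetP[y /= yt ->]; apply/Dt; rewrite psiK' -mem_l1_ball.
rewrite set_fsetK card_imfset /=; last exact: can_inj psiK'.
by rewrite undup_id ?l1_ball_uniq.
Qed.

Lemma cross_polytope_dilate n t (z : 'rV[int]_n) : (0 < t)%N ->
  [set t%:R *: x | x in cross_polytope R n] (map_mx intr z) <->
  \sum_i `|z 0 i| <= t%:Z.
Proof.
move=> t0; have tR : 0 < t%:R :> R by rewrite ltr0n.
have E (x : 'rV[R]_n) : t%:R *: x = map_mx intr z ->
    t%:R * \sum_i `|x 0 i| = (\sum_i `|z 0 i|)%:~R.
  move=> /rowP xz; rewrite mulr_sumr rmorph_sum; apply: eq_bigr => i _ /=.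
  by have := xz i; rewrite !mxE intr_norm => <-; rewrite normrM gtr0_norm.
have tz : (\sum_i `|z 0 i| <= t%:Z) = ((\sum_i `|z 0 i|)%:~R <= t%:R * 1 :> R).
  by rewrite mulr1 -[t%:R]/((t%:Z)%:~R) ler_int.
rewrite tz; split=> [[x x1 /E <-]|zt]; first by rewrite ler_pM2l.
have xz : t%:R *: (t%:R^-1 *: map_mx intr z) = map_mx intr z :> 'rV[R]_n.
  by rewrite scalerA divff ?scale1r // gt_eqF.
exists (t%:R^-1 *: map_mx intr z) => //.
by rewrite /cross_polytope /= -(ler_pM2l tR) (E _ xz).
Qed.

Lemma ehrhart_cross_polytope n t : (0 < t)%N ->
  ehrhart (cross_polytope R n) t = delannoy n t.
Proof.
move=> t0; apply: (@ehrhart_delannoy _ _ id); first by exists id.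
by move=> z; exact: cross_polytope_dilate.
Qed.

(* Taking differences in [t] lowers [m], so a combination vanishing for all
   [t > 0] vanishes at [t = 0] as well. *)
Lemma binomial_comb0 n (h : 'I_n.+1 -> rat) :
  (forall t, (0 < t)%N -> \sum_(k < n.+1) h k * 'C(t + n - k, n)%:R = 0) ->
  forall k, h k = 0.
Proof.
move=> h0; pose f m t := \sum_(k < n.+1) h k * 'C(t + n - k, m)%:R.
have fS m t : f m.+1 t.+1 = f m.+1 t + f m t.
  rewrite -big_split; apply: eq_bigr => k _ /=; rewrite -mulrDr -natrD -binS.
  by congr (_ * 'C(_, _)%:R); have := ltn_ord k; lia.
have fpos j : (j <= n)%N -> forall t, (0 < t)%N -> f (n - j)%N t = 0.
  elim: j => [|j IHj] jn t t0; first by rewrite subn0; exact: h0.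
  have nj : (n - j = (n - j.+1).+1)%N by lia.
  have := fS (n - j.+1)%N t; rewrite -nj !IHj ?(ltnW jn) // add0r.
  by move=> ->.
(* For [m = 0] the sum is independent of [t]; afterwards [f m.+1 0 = f m.+1 1 - f m 0]. *)
have fz m : (m <= n)%N -> f m 0%N = 0.
  elim: m => [|m IHm] mn.
    rewrite -(fpos n (leqnn n) 1%N) // subnn.
    by apply: eq_bigr => k _; rewrite !bin0.
  have := fS m 0%N; rewrite IHm ?(ltnW mn) // addr0 => <-.
  by rewrite -(subKn mn) fpos // leq_subr.
have fn t : f n t = 0.
  by case: t => [|t]; [exact: fz|rewrite -(subn0 n) fpos].
move=> [k kn]; elim/ltn_ind: k kn => k IHk kn.
(* At [t = k] the coefficient of [h k] is 1; smaller indices vanish by induction, and an index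
   [i > k] because [k + n - i < n]. *)
have := fn k; rewrite /f (bigD1 (Ordinal kn)) //= addKn binn mulr1 big1 ?addr0 //.
move=> [i ile] /= ik; have {ik} : i != k by [].
rewrite neq_ltn => /orP[ik|ki]; first by rewrite IHk ?mul0r.
by rewrite bin_small ?mulr0 //; lia.
Qed.

(** [xget] returns some solution; [binomial_comb0], applied to its difference with the binomial one,
    identifies it. *)
Lemma hstar_delannoy n (D : set 'rV[R]_n) :
  (forall t, (0 < t)%N -> ehrhart D t = delannoy n t) ->
  hstar D = [ffun k : 'I_n.+1 => 'C(n, k)%:R].
Proof.
move=> Dt; rewrite /hstar.
set h := [ffun k : 'I_n.+1 => 'C(n, k)%:R].
have hD : is_hstar D h.
  move=> t t0; rewrite Dt // natr_sum; apply: eq_bigr => k _.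
  by rewrite ffunE natrM.
case: xgetP => [g _ gD|/(_ h) //].
apply/ffunP => k; apply/eqP; rewrite -subr_eq0.
rewrite (@binomial_comb0 n (fun k => g k - h k)) // => t t0.
under eq_bigr do rewrite mulrBl.
by rewrite sumrB -gD // -hD // subrr.
Qed.

End Ehrhart.

(** * Polytopes spanned by the generators of a fan *)

Section SpannedPolytope.
Variables (R : realType) (n : nat).

(* [spanned_support] says that the maximal cones are the cones over facets. *)
Record spanned_by (C : 'M[int]_n -> Prop) (D : set 'rV[R]_n) : Prop := {
  spanned_integral : integral_polytope D;
  spanned0 : D 0;
  spanned_row : forall V i, C V -> D (row i (map_mx intr V));
  spanned_support : forall V, C V -> exists y : 'rV[R]_n,
    [/\ forall x, D x -> -1 <= dot x y,
        forall i, dot (row i (map_mx intr V)) y = -1 &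
        forall V' i, C V' -> dot (row i (map_mx intr V')) y = -1 ->
          exists k, row i V' = row k V] }.

Variables (C : 'M[int]_n -> Prop) (psi : 'rV[int]_n -> 'rV[int]_n).
Variable D : set 'rV[R]_n.
Hypotheses (Cpsi : l1_fan C psi) (CD : spanned_by C D).

Lemma dot_cone (V : 'M[int]_n) (a : 'rV[int]_n) (y : 'rV[R]_n) :
  dot (map_mx intr (a *m V)) y = \sum_i (a 0 i)%:~R * dot (row i (map_mx intr V)) y.
Proof. by rewrite map_mxM dot_mulmx; apply: eq_bigr => i _; rewrite mxE. Qed.

Lemma spanned_dilate t z : (0 < t)%N ->
  [set t%:R *: x | x in D] (map_mx intr z) <-> \sum_i `|psi z 0 i| <= t%:Z.
Proof.
move=> t0; have tR : 0 < t%:R :> R by rewrite ltr0n.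
have [V [a [CV a0 zE <-]]] := Cpsi.2 z.
have aE : \sum_i (a 0 i)%:~R = (\sum_i a 0 i)%:~R :> R by rewrite rmorph_sum.
split=> [[x Dx xz]|at_].
  (* Since [y] is -1 on the generators, its value at [z] is minus the degree of [z]. *)
  have [y [yD yV _]] := spanned_support CD CV.
  have : t%:R * -1 <= dot (map_mx intr z) y.
    by rewrite -xz dotZl ler_pM2l // yD.
  rewrite zE dot_cone; under eq_bigr do rewrite yV.
  by rewrite -mulr_suml aE !mulrN1 lerN2 -[t%:R]/((t%:Z)%:~R) ler_int.
have {at_}aR : (\sum_i a 0 i)%:~R <= t%:R :> R.
  by rewrite -[t%:R]/((t%:Z)%:~R) ler_int.
exists (t%:R^-1 *: map_mx intr z); last by rewrite scalerA divff ?scale1r // gt_eqF.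
have [m [U DU]] := spanned_integral CD.
(* The weight left over by the generators goes to the origin, which lies in [D]. *)
have -> : t%:R^-1 *: map_mx intr z =
    row_mx (t%:R^-1 *: map_mx intr a) (1 - t%:R^-1 * (\sum_i a 0 i)%:~R)%:M *m
    col_mx (map_mx intr V) (0 : 'rV[R]_n).
  by rewrite mul_row_col mulmx0 addr0 -scalemxAl -map_mxM -zE.
rewrite DU; apply: conv_hull_comb => [i||i _]; rewrite -?DU.
- case: (split_ordP i) => j ->.
    by rewrite row_mxEl !mxE mulr_ge0 ?invr_ge0 ?ler0z ?(ltW tR).
  by rewrite row_mxEr mxE ord1 eqxx mulr1n subr_ge0 mulrC ler_pdivrMr ?mul1r.
- rewrite big_split_ord big_ord1 /= row_mxEr mxE eqxx mulr1n.
  under eq_bigr do rewrite row_mxEl !mxE.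
  by rewrite -mulr_sumr aE addrC subrK.
- case: (split_ordP i) => j ->; first by rewrite rowKu; exact: (spanned_row CD).
  by rewrite rowKd row0; exact: (spanned0 CD).
Qed.

Lemma spanned_ehrhart t : bijective psi -> (0 < t)%N -> ehrhart D t = delannoy n t.
Proof. by move=> psiB t0; apply: (ehrhart_delannoy psiB) => z; apply: spanned_dilate. Qed.

(** The degree is at most 1 on [D] and is a sum of nonnegative integers, so a single coefficient is
    nonzero and it equals 1. *)
Lemma lattice_point_spanned z : D (map_mx intr z) -> z != 0 ->
  exists V i, C V /\ z = row i V.
Proof.
move=> Dz z0; have [V [a [CV a0 zE aE]]] := Cpsi.2 z.
have a1 : \sum_i a 0 i <= 1.
  rewrite aE; apply/(@spanned_dilate 1) => //.
  by exists (map_mx intr z); rewrite ?scale1r.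
have [i ai] : exists i, a 0 i != 0.
  apply/existsP; apply: contraNT z0; rewrite negb_exists => /forallP az.
  rewrite zE; suff -> : a = 0 by rewrite mul0mx.
  by apply/rowP => i; rewrite mxE; apply/eqP; have := az i; rewrite negbK.
exists V, i; split=> //; rewrite zE rowE; congr (_ *m _).
have ai1 : 1 <= a 0 i by have := a0 i; lia.
move: a1; rewrite (bigD1 i) //=; set s := \sum_(_ | _) _ => a1.
have s0 : 0 <= s by apply: sumr_ge0.
apply/rowP => j; rewrite mxE /=; have [->|ji] := eqVneq j i; first by lia.
apply/eqP; rewrite eq_le a0 andbT.
have : a 0 j <= s by rewrite /s (bigD1 j) //= lerDl sumr_ge0.
by lia.
Qed.

Lemma spanned_full_dim :
  exists S : 'M[R]_(n.+1, n), affinely_independent S /\ forall i, D (row i S).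
Proof.
have [V [_ [CV _ _ _]]] := Cpsi.2 0.
have Vu : map_mx intr V \in @unitmx R n by apply: map_intr_unitmx; exact: Cpsi.1.
exists (col_mx (0 : 'rV_n) (map_mx intr V)); split=> [|i].
  apply/row_freeP.
  exists (block_mx (- invmx (map_mx intr V) *m const_mx 1) (invmx (map_mx intr V))
                   1%:M 0 : 'M_(n + 1, 1 + n)).
  have -> : row_mx (col_mx (0 : 'rV_n) (map_mx intr V)) (const_mx 1) =
      block_mx 0 (const_mx 1) (map_mx intr V) (const_mx 1) :> 'M[R]_(1 + n, n + 1).
    by rewrite block_mxEh col_mx_const.
  rewrite [LHS](@mulmx_block _ 1 n n 1 1 n).
  rewrite !mul0mx !mulmx0 !add0r !addr0 !mulmx1 mulmxA mulmxN mulmxV // mulNmx mul1mx.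
  rewrite addNr [RHS](@scalar_mx_block _ 1 n); 
  apply: (congr1 (fun u => @block_mx R 1 n 1 n u _ _ _)).
  by apply/rowP => i; rewrite !mxE !ord1.
case: (@split_ordP 1 n i) => j ->.
  by rewrite [row _ _](@rowKu R 1 n) row0; exact: (spanned0 CD).
by rewrite [row _ _](@rowKd R 1 n); exact: (spanned_row CD).
Qed.

(* For the facet [dot x a = b], the vector [p := - a / b] is at least [-1] on
   [D], with equality on the facet.  Let [z] be the sum of the lattice points of
   the facet and [y] the support vector of a cone containing [z]: bounding the
   values of [p] and [y] at [z] from below forces [y = -1] on the whole facet,
   which spans, so [y = p]. *)
Lemma spanned_facet F : facet D F -> exists2 V, C V & F = conv_hull (map_mx intr V).
Proof.
move=> [[a [b [Dab FE]]] [[W [Wfree FW]] Fsmall]].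
have [m [U DU]] := spanned_integral CD.
have b0 : 0 <= b by have := Dab _ (spanned0 CD); rewrite dot0l.
(* If [b = 0], then [a] is nonpositive on all lattice points, as the cones cover them. Hence [a = 0]
   and the facet is all of [D], which has too large an affine rank. *)
have {b0}b0 : 0 < b.
  rewrite lt_neqAle b0 andbT; apply/eqP => bz; apply: Fsmall.
  have Dle0 z : dot (map_mx intr z) a <= 0.
    have [V [c [CV c0 -> _]]] := Cpsi.2 z; rewrite dot_cone.
    apply: sumr_le0 => i _; rewrite mulr_ge0_le0 ?ler0z //.
    by rewrite bz Dab //; exact: (spanned_row CD).
  have a0 : a = 0.
    apply/rowP => i; rewrite mxE; apply/eqP; rewrite eq_le.
    have := Dle0 (delta_mx 0 i); rewrite map_delta_mx dot_delta => ->.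
    have := Dle0 (- delta_mx 0 i).
    by rewrite map_mxN map_delta_mx dotNl dot_delta oppr_le0.
  have [S [Sfree SD]] := spanned_full_dim; exists S; split=> // i.
  by rewrite FE /= -bz a0 dotC dot0l.
pose p := - b^-1 *: a.
have pa x : dot x p = - (b^-1 * dot x a) by rewrite dotZr mulNr.
have pE x : (dot x p == -1) = (dot x a == b).
  rewrite pa eqr_opp; apply/eqP/eqP => [h|->]; last by rewrite mulVf // gt_eqF.
  by rewrite -[dot x a](mulVKf (lt0r_neq0 b0)) h mulr1.
have pD x : D x -> -1 <= dot x p.
  by move=> Dx; rewrite pa lerN2 mulrC ler_pdivrMr ?mul1r ?Dab.
have {}FE x : F x <-> D x /\ dot x p = -1.
  rewrite FE /=; split=> -[Dx] /eqP; first by rewrite -pE => /eqP.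
  by rewrite pE => /eqP.
have Wp i : dot (row i W) p = -1 by have /FE[] := FW i.
(* The hyperplane [p = -1] misses the origin, so affinely independent points on it are linearly
   independent: the column of ones is a combination of the columns of [W]. *)
have Wu : W \in unitmx.
  have WE : row_mx W (const_mx 1) = W *m row_mx 1%:M (- p^T).
    rewrite mul_mx_row mulmx1; congr row_mx; apply/colP => i.
    by rewrite mulmxN [LHS]mxE [RHS]mxE mulmx_trE Wp opprK.
  rewrite -row_free_unit /row_free eqn_leq rank_leq_row.
  rewrite -{1}(eqP Wfree) WE; exact: mxrankM_maxl.
pose T := [pred j | dot (map_mx intr (row j U)) p == -1].
pose z := \sum_(j in T) row j U.
have [V [c [CV c0 zE cE]]] := Cpsi.2 z.
have [y [yD yV yC]] := spanned_support CD CV.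
have uD j : D (map_mx intr (row j U)).
  by rewrite DU map_row; apply: conv_hull_row.
have zR : map_mx intr z = \sum_(j in T) map_mx intr (row j U) :> 'rV[R]_n.
  by rewrite map_mx_sum.
have cT : #|T|%:R <= \sum_i (c 0 i)%:~R :> R.
  have : dot (map_mx intr z) p = - #|T|%:R.
    rewrite zR dot_sumr (eq_bigr (fun=> -1)) => [|j /eqP //].
    by rewrite sumr_const mulNrn.
  rewrite {1}zE dot_cone -lerN2 => <-.
  rewrite -sumrN; apply: ler_sum => i _.
  rewrite -mulrN1 ler_wpM2l ?ler0z //; apply: pD; exact: (spanned_row CD).
have Ty j : j \in T -> dot (map_mx intr (row j U)) y = -1.
  move=> jT; apply/eqP; rewrite -subr_eq0 opprK; apply/eqP.
  apply: (psumr_eq0P (P := [in T])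
    (F := fun j => dot (map_mx intr (row j U)) y + 1)) => //.
    by move=> k _; rewrite -lerBlDr sub0r yD.
  apply/eqP; rewrite eq_le sumr_ge0 ?andbT; last first.
    by move=> k _; rewrite -lerBlDr sub0r yD.
  rewrite big_split sumr_const /= -dot_sumr -zR zE dot_cone.
  under eq_bigr do rewrite yV mulrN1.
  by rewrite sumrN addrC subr_le0.
have tight (w : 'rV[R]_m) j : (forall j, 0 <= w 0 j) -> \sum_j w 0 j = 1 ->
    dot (w *m map_mx intr U) p = -1 -> w 0 j != 0 -> j \in T.
  move=> w0 w1 wp wj; apply/eqP; rewrite map_row.
  by apply: (conv_hull_tight w0 w1 _ wp wj) => k; rewrite -map_row; exact: pD (uD k).
have Wy i : dot (row i W) y = -1.
  have /FE[] := FW i; rewrite {1}DU => -[w [w0 w1] <-] wp.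
  rewrite dot_mulmx -[RHS]mulrN1 -[X in _ = X * _]w1 mulr_suml; apply: eq_bigr => j _.
  have [->|wj] := eqVneq (w 0 j) 0; first by rewrite !mul0r.
  by rewrite -map_row Ty //; exact: (tight w).
have yp : y = p.
  apply: trmx_inj; apply: (can_inj (mulKmx Wu)); apply/colP => i.
  by rewrite !mulmx_trE Wp Wy.
subst y; exists V => //; apply/seteqP; split => x.
  move=> /FE[]; rewrite {1}DU => -[w [w0 w1] <-] wp.
  apply: conv_hull_comb => // j wj.
  have jT : j \in T by exact: (tight w).
  have u0 : row j U != 0.
    apply: contra_eq_neq (Ty j jT) => ->.
    by rewrite map_mx0 dot0l eq_sym oppr_eq0 oner_eq0.
  (* Spanning lattice points on the facet are nonzero, hence generators of some cone; [yC] then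
     places them among the generators in [V]. *)
  have [V' [i [CV' uE]]] := lattice_point_spanned (uD j) u0.
  have [|k kE] := yC _ i CV'; first by rewrite -map_row -uE Ty.
  by rewrite -map_row uE kE map_row; apply: conv_hull_row.
move=> Vx; apply/FE; split.
  rewrite DU; apply: (conv_hull_sub _ Vx) => j; rewrite -DU; exact: (spanned_row CD).
have [w [w0 w1] <-] := Vx; rewrite dot_mulmx.
by under eq_bigr do rewrite yV; rewrite -mulr_suml w1 mul1r.
Qed.

Lemma spanned_toric_diagram : toric_diagram D.
Proof.
split; [split|split].
- split.
    exact: spanned_full_dim.
  move=> [V [/eqP Vfree _]].
  by have := rank_leq_col (row_mx V (const_mx 1 : 'cV[R]_n.+2)); rewrite Vfree addn1 ltnn.
- have [m [U ->]] := spanned_integral CD; by exists m, (map_mx intr U).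
- exact: (spanned_integral CD).
- move=> F /spanned_facet [V CV ->]; exists V; split=> //; exists 0.
  suff -> : \matrix_i (row i V + 0) = V by exact: Cpsi.1.
  by apply/row_matrixP => i; rewrite rowK addr0.
Qed.
End SpannedPolytope.

(** * The diagram of a monotone Bott manifold *)

Section MonotoneBott.
Variables (R : realType) (n : nat).

Lemma dot_intr (u v : 'rV[int]_n) :
  dot (map_mx intr u) (map_mx intr v) = (\sum_i u 0 i * v 0 i)%:~R :> R.
Proof. by rewrite rmorph_sum; apply: eq_bigr => i _; rewrite !mxE -rmorphM. Qed.

Lemma primitive_vector_neq0 (v : 'rV[int]_n) : primitive_vector v -> v != 0.
Proof.
move=> v1; apply/eqP => v0; move: v1; rewrite /primitive_vector v0.
by rewrite big1 // => i _; rewrite mxE.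
Qed.

Lemma prequantization_diagramP (P : set 'rV[R]_n) x :
  prequantization_diagram P x <-> forall y, P y -> -1 <= dot x y.
Proof.
split=> [[z zP <-] y Py|xP]; first by rewrite dotNl lerN2 zP.
by exists (- x); [move=> y Py; rewrite dotNl lerNl xP|rewrite opprK].
Qed.

Variable P : set 'rV[R]_n.
Hypothesis hP : monotone_bott_polytope P.

Lemma monotone_bott_ge nu x : facet_normal P nu -> P x -> -1 <= dot x (map_mx intr nu).
Proof.
by move=> Pnu; rewrite {1}(mbp_monotone hP) => /(_ _ Pnu); rewrite -lerBlDr sub0r.
Qed.

Lemma monotone_bott0 : P 0.
Proof. by rewrite (mbp_monotone hP) => nu _; rewrite dot0l add0r ler01. Qed.

(** Otherwise the polar contains every negative multiple of [nu], although it is the hull of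
    finitely many points. *)
Lemma facet_normal_not_ge0 nu : facet_normal P nu ->
  ~ (forall x, P x -> 0 <= dot x (map_mx intr nu)).
Proof.
move=> [/primitive_vector_neq0 nu0 _] nuP.
have [_ [_ [m [Y polarY]]]] := mbp_reflexive hP.
pose N : R := dot (map_mx intr nu) (map_mx intr nu).
have N1 : 1 <= N.
  rewrite /N dot_intr -[1]/(1%:~R) ler_int -gtz0_ge1 lt_neqAle.
  rewrite sumr_ge0 ?andbT => [|i _]; last by rewrite -expr2 sqr_ge0.
  apply: contra nu0; rewrite eq_sym psumr_eq0 => [/allP nui|i _]; last first.
    by rewrite -expr2 sqr_ge0.
  apply/eqP/rowP => i; rewrite mxE; apply/eqP.
  by have := nui i (mem_index_enum i); rewrite /= -expr2 sqrf_eq0.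
(* All points spanning the polar pair with [nu] to at least [- B], while [- (B + 1) nu] pairs to
   [- (B + 1) N], which is smaller as [N >= 1]. *)
pose B := \sum_j `|dot (row j (map_mx intr Y)) (map_mx intr nu) : R|.
have B0 : 0 <= B by apply: sumr_ge0.
have : polar P (- (B + 1) *: map_mx intr nu).
  move=> y Py; rewrite dotZl mulNr (le_trans _ ler01) // oppr_le0 mulr_ge0 //.
    by rewrite addr_ge0.
  by rewrite dotC nuP.
rewrite polarY => /(@conv_hull_ge _ _ _ _ (map_mx intr nu) (- B)).
rewrite dotZl -/N => BN.
have : - B <= - (B + 1) * N.
  apply: BN => j; rewrite lerNl (le_trans (ler_norm _)) // normrN.
  by rewrite /B (bigD1 j) //= lerDl sumr_ge0.
by nra.
Qed.

Lemma facet_normal_level nu p : facet_normal P nu -> min_face P nu p ->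
  dot p (map_mx intr nu) = -1.
Proof.
move=> Pnu [Pp pmin].
have [_ [[m [U PU]] _]] := mbp_reflexive hP.
(* The minimum is attained at one of the lattice points spanning [P], hence is an integer. *)
have [k kE] : exists k : int, dot p (map_mx intr nu) = k%:~R.
  move: (Pp); rewrite {1}PU => -[w [w0 w1] wp].
  have [j wj] : exists j, w 0 j != 0.
    apply/existsP; apply: contra_eqT w1; rewrite negb_exists => /forallP w1.
    rewrite big1 ?(eq_sym 0) ?oner_neq0 // => j _.
    by apply/eqP; have := w1 j; rewrite negbK.
  exists (\sum_i row j U 0 i * nu 0 i); rewrite -dot_intr map_row; symmetry.
  apply: (conv_hull_tight w0 w1 _ _ wj); last by rewrite wp.
  by move=> i; apply: pmin; rewrite PU; apply: conv_hull_row.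
have k_ge : -1 <= k.
  by have := monotone_bott_ge Pnu Pp; rewrite kE -[-1]/((-1)%:~R) ler_int.
have k_le : k <= 0 by have := pmin _ monotone_bott0; rewrite kE dot0l lerz0.
have k0 : k != 0.
  apply/eqP => k0; apply: (facet_normal_not_ge0 Pnu) => x Px.
  by have := pmin x Px; rewrite kE k0.
by rewrite kE; suff -> : k = -1 by []; lia.
Qed.

(** The support vector of the cone at a vertex [p] is [p] itself. *)
Lemma bott_spanned : spanned_by
  [set V | V \in unitmx /\ normal_fan P [set row i V | i in setT]]
  (prequantization_diagram P).
Proof.
have in_fan V p : [set nu | facet_normal P nu /\ min_face P nu p] =
    [set row i V | i in setT] ->
    forall i, facet_normal P (row i V) /\ min_face P (row i V) p.
  by move=> /seteqP[_ VP] i; apply: (VP (row i V)); exists i.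
split.
- have [_ [_ [m [Y polarY]]]] := mbp_reflexive hP.
  exists m, (- Y); rewrite /prequantization_diagram polarY map_mxN.
  apply/seteqP; split=> x.
    by move=> [_ [w wP <-] <-]; exists w; rewrite ?mulmxN.
  by move=> [w wP <-]; exists (w *m map_mx intr Y); [exists w|rewrite mulmxN].
- by apply/prequantization_diagramP => y _; rewrite dot0l lerN10.
- move=> V i [_ [p _ /in_fan/(_ i)[Pnu _]]].
  apply/prequantization_diagramP => y Py; rewrite dotC -map_row.
  exact: monotone_bott_ge.
move=> V [_ [p [a [b [Pab /seteqP[/(_ p erefl)[Pp _] _]]]] pV]]; exists p; split.
- by move=> x /prequantization_diagramP; apply.
- move=> i; have [Pnu pnu] := in_fan _ _ _ pV i.
  by rewrite dotC -map_row; apply: facet_normal_level.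
- move=> V' i [_ [q _ /in_fan/(_ i)[Pnu _]]]; rewrite dotC -map_row => pnu.
  (* A normal of value -1 at [p] is minimal there, so its facet passes through [p]. *)
  have : [set nu | facet_normal P nu /\ min_face P nu p] (row i V').
    by split=> //; split=> // x Px; rewrite pnu; apply: monotone_bott_ge.
  by rewrite pV => -[k _ kE]; exists k.
Qed.

End MonotoneBott.

(** * Two explicit diagrams, straight and twisted *)

(* The rays are [+-e_i], except that [e_1] is replaced by [e_1 + e_0] when [d]
   holds: this is the fan of (CP^1)^n if [d] is false, and of
   H_1 x (CP^1)^(n-2) if [d] is true. *)
Section TwistedCross.
Variables (R : realType) (m : nat).
Notation n := m.+2.
Let i0 : 'I_n := ord0.
Let i1 : 'I_n := @Ordinal n 1 isT.

Definition twisted_ray (d b : bool) (i : 'I_n) : 'rV[int]_n :=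
  (-1) ^+ b *: delta_mx 0 i + (d && ~~ b && (i == i1))%:R *: delta_mx 0 i0.

Definition twisted_cone d (s : 'I_n -> bool) : 'M[int]_n :=
  \matrix_i twisted_ray d (s i) i.

Definition twisted_cross d : set 'rV[R]_n :=
  conv_hull (map_mx intr (\matrix_(k < #|{: bool * 'I_n}|)
    twisted_ray d (enum_val k).1 (enum_val k).2)).

(** When [d] holds, [max(z_1, 0)] is the piecewise linear function with value 1 at the ray
    [e_1 + e_0] and 0 at the other rays. *)
Definition untwist d (z : 'rV[int]_n) : 'rV[int]_n :=
  z - (d%:R * Num.max (z 0 i1) 0) *: delta_mx 0 i0.

Lemma untwist_i1 d (z : 'rV[int]_n) : untwist d z 0 i1 = z 0 i1.
Proof. by rewrite !mxE /= mulr0 subr0. Qed.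

Lemma untwist_bij d : bijective (untwist d).
Proof.
exists (fun z : 'rV[int]_n => z + (d%:R * Num.max (z 0 i1) 0) *: delta_mx 0 i0) => z.
  by rewrite untwist_i1 subrK.
have E c : (z + c *: delta_mx 0 i0) 0 i1 = z 0 i1 by rewrite !mxE /= mulr0 addr0.
by rewrite /untwist E addrK.
Qed.

Lemma twisted_cone_unit d s : twisted_cone d s \in unitmx.
Proof.
rewrite unitmxE det_trig.
  apply: rpred_prod => i _; rewrite !mxE !eqxx mulr1.
  case: (eqVneq i i1) => [->|_]; first by rewrite mulr0 addr0 unitrX.
  by rewrite andbF mul0r addr0 unitrX.
apply/is_trig_mxP => i j ij; rewrite !mxE /=.
have -> : (j == i) = false by apply/eqP => ji; rewrite ji ltnn in ij.
have -> : (j == i0) = false by apply/eqP => ji; rewrite ji ltn0 in ij.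
by rewrite !mulr0 addr0.
Qed.

Lemma twisted_cross_l1 d : l1_fan [set V | exists s, V = twisted_cone d s] (untwist d).
Proof.
split=> [V [s ->]|z]; first exact: twisted_cone_unit.
pose s i := untwist d z 0 i < 0; pose a := \row_i `|untwist d z 0 i|.
exists (twisted_cone d s), a; split=> [|i||].
- by exists s.
- by rewrite mxE.
- rewrite mulmx_sum_row.
  under eq_bigr do rewrite rowK scalerDr !scalerA.
  rewrite big_split /= -scaler_suml [X in _ + X *: _](bigD1 i1) //=.
  rewrite [X in _ + (_ + X) *: _]big1; last first.
    by move=> i /negPf ->; rewrite andbF mulr0.
  rewrite addr0 eqxx andbT [a 0 i1]mxE /s untwist_i1.
  rewrite (eq_bigr (fun i => untwist d z 0 i *: delta_mx 0 i)); last first.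
    by move=> i _; rewrite mxE mulrC -numEsign.
  rewrite -row_sum_delta.
  (* The excess of [e_1 + e_0] over [e_1] restores what the shear removed. *)
  have -> : `|z 0 i1| * (d && ~~ (z 0 i1 < 0))%:R = d%:R * Num.max (z 0 i1) 0.
    rewrite -leNgt; case: (d); rewrite ?mulr0 ?mul0r // mul1r /=.
    by case: lerP => h; rewrite ?mulr1 ?mulr0 // ger0_norm.
  by rewrite /untwist subrK.
- by apply: eq_bigr => i _; rewrite mxE.
Qed.

Lemma dot_twisted_ray d b i (y : 'rV[R]_n) :
  dot (map_mx intr (twisted_ray d b i)) y =
  (-1) ^+ b * y 0 i + (d && ~~ b && (i == i1))%:R * y 0 i0.
Proof.
rewrite map_mxD !map_mxZ !map_delta_mx dotDl !dotZl !dot_delta.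
by rewrite rmorphXn rmorphN1 /= rmorph_nat.
Qed.

Lemma twisted_cross_ray d b i : twisted_cross d (map_mx intr (twisted_ray d b i)).
Proof.
have := conv_hull_row (map_mx intr (\matrix_(k < #|{: bool * 'I_n}|)
  twisted_ray d (enum_val k).1 (enum_val k).2)) (enum_rank (b, i)) => /(_ R).
by rewrite -map_row rowK enum_rankK.
Qed.

Lemma twisted_cross_ge d c (y : 'rV[R]_n) x :
  (forall b i, c <= dot (map_mx intr (twisted_ray d b i)) y) ->
  twisted_cross d x -> c <= dot x y.
Proof. by move=> ray_ge; apply: conv_hull_ge => k; rewrite -map_row rowK. Qed.

(** The solution [y] of value -1 on the generators of the cone [s]. A ray [+-e_i] forces minus its
    sign, and [e_1 + e_0] forces [y_1 = -1 - y_0], whence the second term. *)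
Definition twisted_support d (s : 'I_n -> bool) : 'rV[R]_n :=
  \row_i (- (-1) ^+ s i + (d && ~~ s i && (i == i1))%:R * (-1) ^+ s i0).

(** Strictness off the cone ensures that a ray of value -1 is one of its generators. *)
Lemma dot_twisted_support d s b i :
  let v := dot (map_mx intr (twisted_ray d b i)) (twisted_support d s) in
  if b == s i then v = -1 else -1 < v.
Proof.
rewrite /= dot_twisted_ray !mxE /= andbF mul0r addr0.
case: (i == i1); case: d; case: b; case: (s _); case: (s _) => /=; lra.
Qed.

Lemma twisted_cross_spanned d :
  spanned_by [set V | exists s, V = twisted_cone d s] (twisted_cross d).
Proof.
split.
- by eexists; eexists; reflexivity.
(* The origin is the midpoint of [e_0] and [- e_0], which are rays for both values of [d]. *)
- have -> : 0 = const_mx 2^-1 *m \matrix_(k < 2)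
      map_mx intr (twisted_ray d (k == 0 :> nat) i0) :> 'rV[R]_n.
    apply/rowP => j; rewrite [RHS]mxE big_ord_recl big_ord1 !mxE /= !andbF !mul0r !addr0.
    by rewrite !rmorphM rmorphXn rmorphN1 /= expr1 expr0; ring.
  apply: conv_hull_comb => [k||k _].
  + by rewrite mxE invr_ge0 ler0n.
  + by rewrite big_ord_recl big_ord1 !mxE -mulr2n -[_ *+ 2]mulr_natr mulVf ?pnatr_eq0.
  + by rewrite rowK; apply: twisted_cross_ray.
- by move=> _ i [s ->]; rewrite -map_row rowK; apply: twisted_cross_ray.
- move=> _ [s ->]; exists (twisted_support d s); split.
  + move=> x; apply: twisted_cross_ge => b i; have := dot_twisted_support d s b i.
    by rewrite /=; case: ifP => [_ -> //|_ /ltW].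
  + move=> i; rewrite -map_row rowK.
    by have := dot_twisted_support d s (s i) i; rewrite /= eqxx.
  + move=> _ i [s' ->]; rewrite -map_row rowK.
    have := dot_twisted_support d s (s' i) i => /=.
    case: eqP => [ss' _ _|_ /lt_eqF/eqP //]; last by move=> h /esym.
    by exists i; rewrite !rowK ss'.
Qed.

End TwistedCross.

(** * Central symmetry as an invariant *)

Section CentralSymmetry.
Variable R : realType.

(** [c] is twice the centre, which is left free because unimodular equivalences include
    translations. *)
Definition centrally_symmetric n (D : set 'rV[R]_n) : Prop :=
  exists c, forall x, D x -> D (c - x).

Lemma centrally_symmetric_equiv n (D D' : set 'rV[R]_n) :
  unimodular_equiv D D' -> centrally_symmetric D <-> centrally_symmetric D'.
Proof.
move=> [A [w [Au ->]]]; set f := map_mx intr A; set u := map_mx intr w.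
have fu : f \in unitmx by exact: map_intr_unitmx.
split=> -[c cD].
  exists (c *m f + u *+ 2) => _ [x Dx <-]; exists (c - x); first exact: cD.
  by rewrite mulmxBl mulr2n opprD addrACA addrK.
exists ((c - u *+ 2) *m invmx f) => x Dx.
have [|x' Dx' x'E] := cD (x *m f + u); first by exists x.
suff -> : (c - u *+ 2) *m invmx f - x = x' by [].
apply: (can_inj (mulmxK fu)); rewrite mulmxBl mulmxKV //.
have -> : x' *m f = c - (x *m f + u) - u by rewrite -x'E addrK.
by rewrite mulr2n !opprD !addrA [LHS]addrAC; congr (_ - _); exact: addrAC.
Qed.

Lemma cross_centrally_symmetric m : centrally_symmetric (@twisted_cross R m false).
Proof.
exists 0 => x [w [w0 w1] <-]; rewrite sub0r -mulmxN.
apply: conv_hull_comb => // k _.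
rewrite -map_mxN -map_row.
rewrite (_ : row k _ = twisted_ray false (~~ (enum_val k).1) (enum_val k).2).
  exact: twisted_cross_ray.
apply/rowP => j; rewrite !mxE /= !mul0r !addr0 signrN mulNr //.
Qed.

(** On the polytope [- x_0], [- x_1] and [x_0 + x_1] are at least -1. At the reflections of [- e_0],
    [- e_1] and [e_0 + e_1] this gives [c_0 <= 0], [c_1 <= 0] and [c_0 + c_1 >= 1]. *)
Lemma twisted_not_centrally_symmetric m : ~ centrally_symmetric (@twisted_cross R m true).
Proof.
move=> [c cD].
set i0 : 'I_m.+2 := ord0; set i1 : 'I_m.+2 := @Ordinal m.+2 1 isT.
have i01 : (i0 == i1) = false by [].
have ge b i := twisted_cross_ge _ (cD _ (twisted_cross_ray R true b i)).
have c0 : -1 <= dot (c - map_mx intr (twisted_ray true true i0)) (- delta_mx 0 i0).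
  apply: ge => b i; rewrite dot_twisted_ray !mxE !eqxx /=.
  by case: (eqVneq i i0) => [->|_]; rewrite ?i01; case: b; try case: (i == i1) => /=; lra.
have c1 : -1 <= dot (c - map_mx intr (twisted_ray true true i1)) (- delta_mx 0 i1).
  apply: ge => b i; rewrite dot_twisted_ray !mxE !eqxx /=.
  case: (i == i1); case: b => /=; lra.
have c2 : -1 <= dot (c - map_mx intr (twisted_ray true false i1))
                    (delta_mx 0 i0 + delta_mx 0 i1).
  apply: ge => b i; rewrite dot_twisted_ray !mxE !eqxx /=.
  by case: (eqVneq i i0) => [->|_]; rewrite ?i01; case: b; try case: (i == i1) => /=; lra.
move: c0 c1 c2; rewrite !dotDl !dotNl !dot_twisted_ray !mxE /= ![dot c _]dotC.
rewrite !dotNl dotDl !dot_delta; lra.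
Qed.

End CentralSymmetry.

(** * Flexibility, and the assembled statement *)

Lemma delannoy_flexible (R : realType) n (D : set 'rV[R]_n) : (2 <= n)%N ->
  (forall t, (0 < t)%N -> ehrhart D t = delannoy n t) -> flexible D.
Proof.
case: n D => [|[|m]] // D _ Dt Drigid.
have D_equiv d : unimodular_equiv D (@twisted_cross R m d).
  have l1 := twisted_cross_l1 m d; have spanned := twisted_cross_spanned R m d.
  apply: Drigid; first exact: (spanned_toric_diagram l1 spanned).
  (* Contact Betti numbers are computed from [hstar], which the common Ehrhart count determines. *)
  have hstarE : hstar (@twisted_cross R m d) = hstar D.
    rewrite !hstar_delannoy // => t t0.
    exact: (spanned_ehrhart l1 spanned (@untwist_bij m d) t0).
  by move=> i; rewrite /contact_betti hstarE.
apply: (@twisted_not_centrally_symmetric R m).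
apply/(centrally_symmetric_equiv (D_equiv true)).
apply/(centrally_symmetric_equiv (D_equiv false)).
exact: cross_centrally_symmetric.
Qed.

Theorem proposition1p4 (R : realType) (n : nat) (P : set 'rV[R]_n)
    (hP : monotone_bott_polytope P)
    (D : set 'rV[R]_n) (hD : D = prequantization_diagram P) :
  toric_diagram D /\
  (forall k : 'I_n.+1, hstar D k = ('C(n, k)%:R)%R) /\
  ((2 <= n)%N -> flexible D) /\
  ehrhart_equiv D (cross_polytope R n) /\
  (forall t : nat, (0 < t)%N ->
     ehrhart D t = ehrhart (cross_polytope R n) t /\
     ehrhart (cross_polytope R n) t =
       (\sum_(k < n.+1) 'C(n, k) * 'C(t + n - k, n))%N).
Proof.
have [psi [psi_bij l1]] := bott_fan_l1 (mbp_bott hP).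
have := bott_spanned hP; rewrite -hD => spanned.
have Dt t (t0 : (0 < t)%N) : ehrhart D t = delannoy n t.
  exact: (spanned_ehrhart l1 spanned psi_bij t0).
have DE t (t0 : (0 < t)%N) : ehrhart D t = ehrhart (cross_polytope R n) t.
  by rewrite Dt // ehrhart_cross_polytope.
split; first exact: (spanned_toric_diagram l1 spanned).
split; first by move=> k; rewrite hstar_delannoy // ffunE.
split; first by move=> n2; apply: delannoy_flexible.
split=> // t t0; split; first exact: DE.
exact: ehrhart_cross_polytope.
Qed.
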